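(* A formal power series $\varphi(x)\in\mathbb{C}[[x]]$ is symplectic if and only if $\varphi(x)=\varphi\big(x/(x-1)\big)$ as formal power series. Moreover, if $\varphi(x)$ is a rational function regular at $x=0$ (identified with its Taylor series at $0$), then the following are equivalent: (1) $\varphi(x)$ is symplectic; (2) there exists a rational function $\rho(y)$ such that $\varphi(x)=\rho\big(x^2/(1-x)\big)$; (3) $\varphi(x)=\varphi\big(x/(x-1)\big)$.
   Context: A formal power series $\varphi(x)=\sum_{i\ge0}\gamma_i x^i\in\mathbb{C}[[x]]$ is called symplectic if for every $m\ge1$ one has $\sum_{k=0}^{m-1}(-1)^k\binom{m-1}{k}\gamma_{m+k}=0$. The substitution $x\mapsto x/(x-1)=-\sum_{j\ge1}x^j$ is a formal composition with a series having zero constant term. *)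

(* Defs.v *)
From HB Require Import structures.
From mathcomp Require Import all_boot all_order all_algebra.
From mathcomp Require Import complex.
From mathcomp Require Import reals.
Set Implicit Arguments. Unset Strict Implicit. Unset Printing Implicit Defensive.
Import Order.TTheory GRing.Theory Num.Theory.
Local Open Scope ring_scope.

Definition fps (K : comNzRingType) := nat -> K.

Definition fps_mul (K : comNzRingType) (f g : fps K) : fps K :=
  fun n => \sum_(i < n.+1) f i * g (n - i)%N.

Definition fps_one (K : comNzRingType) : fps K := fun n => if n is 0%N then 1 else 0.

Definition fps_pow (K : comNzRingType) (g : fps K) (i : nat) : fps K :=
  iter i (fps_mul g) (@fps_one K).

(* Formal composition phi(g(x)), meaningful when g 0 = 0:
   [x^n] phi(g) = sum_{i <= n} gamma_i [x^n] g^i. *)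
Definition fps_comp (K : comNzRingType) (phi g : fps K) : fps K :=
  fun n => \sum_(i < n.+1) phi i * fps_pow g i n.

Definition fps_of_poly (K : comNzRingType) (p : {poly K}) : fps K := fun n => p`_n.

(* x/(x-1) = - sum_{j>=1} x^j *)
Definition fps_xx1 (K : comNzRingType) : fps K := fun n => if n is 0%N then 0 else -1.

Definition symplectic (K : comNzRingType) (phi : fps K) : Prop :=
  forall m : nat, (1 <= m)%N ->
    \sum_(k < m) (-1) ^+ k * ('C(m.-1, k))%:R * phi (m + k)%N = 0.

Definition taylor_of_rat (K : comNzRingType) (P Q : {poly K}) (phi : fps K) : Prop :=
  Q.[0] != 0 /\ fps_mul (fps_of_poly Q) phi = fps_of_poly P.

(* Main.v *)
(* For a_j = gamma_{j+1} put b(p+1,q) = b(p,q) - b(p,q+1) with b(0,q) = a_q.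
   Being symplectic says that b vanishes on the diagonal, and invariance under
   x -> x/(x-1) says that b(n,0) = - b(0,n); by the recurrence, both are
   equivalent to b being antisymmetric.  For phi = P/Q, invariance is the
   identity P(x) Q(v) = Q(x) P(v) with v = x/(x-1).  Both x and v are roots of
   t^2 = u (1 - t) for u = x^2/(1-x), so each polynomial in t = x, v is a + b t
   with a, b polynomials in u, and the identity forces P/Q to be a quotient of
   polynomials in u. *)
Require Import Defs.
From HB Require Import structures.
From mathcomp Require Import all_boot all_order all_algebra.
From mathcomp Require Import complex.
From mathcomp Require Import boolp reals.
From mathcomp Require Import ring.
Set Implicit Arguments. Unset Strict Implicit. Unset Printing Implicit Defensive.
Import Order.TTheory GRing.Theory Num.Theory.
Local Open Scope ring_scope.

(** * Difference tables and invariance under x -> x/(x-1) *)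

Section DifferenceTable.
Variable K : idomainType.
Implicit Types (a : nat -> K) (phi : fps K).

Fixpoint diff_table a (p q : nat) : K :=
  if p is p'.+1 then diff_table a p' q - diff_table a p' q.+1 else a q.

(** Pascal's rule. With a_j = gamma_{j+1}, the entry at p = q = m - 1 is the m-th symplectic sum. *)
Lemma diff_tableE a p q :
  diff_table a p q = \sum_(k < p.+1) (-1) ^+ k * 'C(p, k)%:R * a (q + k)%N.
Proof.
elim: p q => [|p IHp] q /=.
  by rewrite big_ord1 bin0 expr0 !mul1r addn0.
rewrite !IHp big_ord_recl [RHS]big_ord_recl !bin0 -addrA; congr (_ + _).
rewrite [RHS](eq_bigr (fun k : 'I_p.+1 =>
    (-1) ^+ k.+1 * 'C(p, k.+1)%:R * a (q + k.+1)%N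
    - (-1) ^+ k * 'C(p, k)%:R * a (q.+1 + k)%N)); last first.
  move=> k _; rewrite binS natrD addSnnS exprS; ring.
rewrite sumrB [X in _ = X - _]big_ord_recr /= bin_small // mulr0 mul0r addr0.
by congr (_ - _); apply: eq_bigr.
Qed.

(** The recurrence b(p,q) = b(p+1,q) + b(p,q+1) is symmetric in its two directions, so antisymmetry
    propagates from the row p = 0. *)
Lemma diff_table_antisym a :
  (forall n, diff_table a n 0 = - a n) ->
  forall p q, diff_table a p q = - diff_table a q p.
Proof.
move=> a0; elim=> [|p IHp] q; first by rewrite a0 opprK.
by rewrite /= !IHp /=; ring.
Qed.

(* The symmetrisation e(p,q) = b(p,q) + b(q,p) obeys the same recurrence as the
   table b, so it vanishes off the diagonal by induction on the distance to it. *)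
Lemma diff_table_diag0 a : (2 : K) != 0 ->
  (forall m, diff_table a m m = 0) ->
  forall p q, diff_table a p q = - diff_table a q p.
Proof.
move=> nz2 diag0.
have step p q : diff_table a p q.+1 + diff_table a q.+1 p =
    (diff_table a p q + diff_table a q p)
    - (diff_table a p.+1 q + diff_table a q p.+1).
  by rewrite /=; ring.
have sym0 d p : diff_table a p (p + d) + diff_table a (p + d) p = 0.
  elim/ltn_ind: d p => -[|[|d]] IHd p.
  - by rewrite addn0 diag0 addr0.
  (* Next to the diagonal the recurrence only yields e = -e, hence the division by 2. *)
  - rewrite addn1; apply: (mulfI nz2); rewrite mulr0.
    have := step p p; rewrite diag0 addr0 sub0r => E.
    by rewrite mulr_natl mulr2n {1}E [diff_table a p p.+1 + _]addrC addNr.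
  - rewrite addnS step IHd // add0r addnS -addSn IHd ?oppr0 //.
move=> p q; apply/eqP; rewrite -addr_eq0; apply/eqP.
case/orP: (leq_total p q) => /subnKC <-; first exact: sym0.
by rewrite addrC sym0.
Qed.

(** Coefficient form of (x - 1) h = x g, where h = g x/(x-1). *)
Lemma fps_mul_xx1S (g : fps K) n :
  fps_mul (@fps_xx1 K) g n.+1 = fps_mul (@fps_xx1 K) g n - g n.
Proof.
have E m : fps_mul (@fps_xx1 K) g m.+1 = - \sum_(j < m.+1) g j.
  rewrite /fps_mul big_ord_recl /= mul0r add0r -sumrN.
  rewrite (reindex_inj rev_ord_inj) /=; apply: eq_bigr => i _.
  by rewrite mulN1r /bump /= add1n subSS subSS subKn // -ltnS.
rewrite E big_ord_recr /= opprD; congr (_ - _).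
case: n => [|n]; last by rewrite E.
by rewrite big_ord0 oppr0 /fps_mul big_ord1 mul0r.
Qed.

Lemma fps_pow_xx1S0 i : fps_pow (@fps_xx1 K) i.+1 0 = 0.
Proof. by rewrite /fps_pow iterS /fps_mul big_ord1 mul0r. Qed.

Lemma fps_pow_xx1 i n :
  fps_pow (@fps_xx1 K) i.+1 n.+1 = (-1) ^+ i.+1 * 'C(n, i)%:R.
Proof.
have rec j m : fps_pow (@fps_xx1 K) j.+1 m.+1 =
    fps_pow (@fps_xx1 K) j.+1 m - fps_pow (@fps_xx1 K) j m.
  exact: fps_mul_xx1S.
elim: n i => [|n IHn] i; rewrite rec.
  rewrite fps_pow_xx1S0 sub0r; case: i => [|i].
    by rewrite bin0 expr1 mulr1.
  by rewrite fps_pow_xx1S0 bin0n oppr0 mulr0.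
rewrite IHn; case: i => [|i]; first by rewrite !bin0 subr0.
by rewrite IHn binS natrD !exprS; ring.
Qed.

Lemma fps_comp_xx1 phi n :
  fps_comp phi (@fps_xx1 K) n.+1 = - diff_table (fun j => phi j.+1) n 0.
Proof.
rewrite diff_tableE /fps_comp big_ord_recl [X in X + _]mulr0 add0r -sumrN.
apply: eq_bigr => i _; rewrite lift0 fps_pow_xx1 add0n exprS; ring.
Qed.

Lemma symplectic_fixed phi : (2 : K) != 0 ->
  symplectic phi <-> phi = fps_comp phi (@fps_xx1 K).
Proof.
move=> nz2; pose a j := phi j.+1; split => [sym | fixed].
- have diag0 m : diff_table a m m = 0.
    rewrite diff_tableE -[RHS](sym m.+1) //.
  (* The constant term is kept by any substitution, so only positive degrees use the table. *)
  apply/funext => -[|n].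
    by rewrite /fps_comp big_ord1 mulr1.
  by rewrite fps_comp_xx1 -/a -(diff_table_diag0 nz2 diag0 0 n).
- have a0 n : diff_table a n 0 = - a n.
    by rewrite /a [in RHS]fixed fps_comp_xx1 opprK.
  case=> // m _; have := diff_table_antisym a0 m m.
  move/eqP; rewrite -addr_eq0 -mulr2n -mulr_natl mulf_eq0 (negPf nz2) /=.
  by move/eqP; rewrite diff_tableE.
Qed.

End DifferenceTable.

(** * Homogenization of polynomials *)

Section Homogenization.
Variable K : comNzRingType.
Implicit Type p : {poly K}.

(** A division-free form of b^N p(a/b). The sum stops below [N], so [N] has to bound the size of
    [p]. *)
Definition homog (F : comNzRingType) (e : K -> F) N (p : {poly K}) (a b : F) : F :=
  \sum_(i < N) e p`_i * a ^+ i * b ^+ (N - i).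

Lemma homogE (F : comNzRingType) (e : {rmorphism K -> F}) N p (b s : F) :
  (size p <= N)%N -> homog e N p (b * s) b = b ^+ N * (map_poly e p).[s].
Proof.
move=> leN; rewrite (horner_coef_wide _ (leq_trans (size_poly _ _) leN)).
rewrite mulr_sumr; apply: eq_bigr => i _.
have -> : b ^+ N = b ^+ (N - i) * b ^+ i by rewrite -exprD subnK // ltnW.
rewrite coef_map /= exprMn; ring.
Qed.

Lemma rmorph_homog (F G : comNzRingType) (e : K -> F) (f : {rmorphism F -> G})
    N p a b :
  f (homog e N p a b) = homog (f \o e) N p (f a) (f b).
Proof.
rewrite rmorph_sum; apply: eq_bigr => i _.
by rewrite !rmorphM !rmorphXn.
Qed.

End Homogenization.

(** * Power series through truncations modulo powers of x *)

Section Truncation.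
Variable K : idomainType.
Implicit Types (p q r s : {poly K}) (f g : fps K).

(** Congruence modulo ['X ^+ n]: as [fps] is a bare function type, ring arguments on series are run
    on polynomial truncations. *)
Definition eqX n p q := forall k, (k < n)%N -> p`_k = q`_k.

Lemma eqXM n p1 q1 p2 q2 : eqX n p1 q1 -> eqX n p2 q2 ->
  eqX n (p1 * p2) (q1 * q2).
Proof.
move=> E1 E2 k lt_kn; rewrite !coefM; apply: eq_bigr => i _.
rewrite E1 ?E2 //; first exact: leq_ltn_trans (leq_subr _ _) lt_kn.
by apply: leq_ltn_trans lt_kn; rewrite -ltnS.
Qed.

Lemma eqXX n p q i : eqX n p q -> eqX n (p ^+ i) (q ^+ i).
Proof. by move=> E; elim: i => // i IHi; rewrite !exprS; apply: eqXM. Qed.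

Lemma eqX_trans n q p r : eqX n p q -> eqX n q r -> eqX n p r.
Proof. by move=> E1 E2 k lt_kn; rewrite E1 ?E2. Qed.

Lemma eqX_sym n p q : eqX n p q -> eqX n q p.
Proof. by move=> E k lt_kn; rewrite E. Qed.

Lemma eqX_all p q : (forall n, eqX n p q) -> p = q.
Proof. by move=> E; apply/polyP => k; apply: (E k.+1). Qed.

(** The constant term of [r] need not be a unit, so coefficients are compared in increasing order:
    once the lower ones agree, degree k leaves r_0 p_k = r_0 q_k. *)
Lemma eqX_cancel n r p q : r`_0 != 0 -> eqX n (r * p) (r * q) -> eqX n p q.
Proof.
move=> r0 E k; elim/ltn_ind: k => k IHk lt_kn.
have := E k lt_kn; rewrite !coefM !big_ord_recl /= !subn0.
rewrite [X in _ = _ + X -> _](eq_bigr (fun i : 'I_k =>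
    r`_(lift ord0 i) * p`_(k - lift ord0 i))).
  by move=> /addIr /(mulfI r0).
move=> i _; rewrite lift0 IHk //.
  by rewrite ltn_subrL /= (leq_ltn_trans _ (ltn_ord i)).
exact: leq_ltn_trans (leq_subr _ _) lt_kn.
Qed.

Definition trunc n f : {poly K} := \poly_(i < n) f i.

Lemma coef_trunc n f k : (k < n)%N -> (trunc n f)`_k = f k.
Proof. by rewrite coef_poly => ->. Qed.

Lemma eqX_truncM n f g : eqX n (trunc n f * trunc n g) (trunc n (fps_mul f g)).
Proof.
move=> k lt_kn; rewrite coefM coef_trunc //; apply: eq_bigr => i _.
rewrite !coef_trunc //; first exact: leq_ltn_trans (leq_subr _ _) lt_kn.
by apply: leq_ltn_trans lt_kn; rewrite -ltnS.
Qed.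

Lemma eqX_truncX n f i : eqX n (trunc n f ^+ i) (trunc n (fps_pow f i)).
Proof.
elim: i => [|i IHi].
  by move=> [|k] lt_kn; rewrite expr0 coef_trunc // coef1.
rewrite exprS; apply: eqX_trans (eqX_truncM f (fps_pow f i)).
exact: eqXM.
Qed.

Lemma coef_exp_lt p i k : p`_0 = 0 -> (k < i)%N -> (p ^+ i)`_k = 0.
Proof.
move=> p0; elim: i k => // i IHi k lt_ki.
rewrite exprS coefM big_ord_recl p0 mul0r add0r big1 // => j _.
rewrite lift0 IHi ?mulr0 //; case: k lt_ki j => [|k] lt_ki j; first by case: j.
by rewrite subSS (leq_ltn_trans (leq_subr _ _)).
Qed.

(** Powers of [s] beyond the k-th start above degree k; what remains has the shape of [fps_comp]. *)
Lemma coef_comp_poly0 p s k : s`_0 = 0 ->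
  (p \Po s)`_k = \sum_(i < k.+1) p`_i * (s ^+ i)`_k.
Proof.
move=> s0; pose N := maxn (size p) k.+1.
rewrite /comp_poly (@horner_coef_wide _ N); last first.
  by rewrite (leq_trans (size_poly _ _)) // leq_maxl.
rewrite coef_sum (big_ord_widen N (fun i => p`_i * (s ^+ i)`_k)) ?leq_maxr //.
rewrite [RHS]big_mkcond; apply: eq_bigr => i _; rewrite coef_map coefCM ltnS.
by case: leqP => // lt_ki; rewrite coef_exp_lt ?mulr0.
Qed.

Lemma eqX_comp n p q s : s`_0 = 0 -> eqX n p q -> eqX n (p \Po s) (q \Po s).
Proof.
move=> s0 E k lt_kn; rewrite !coef_comp_poly0 //; apply: eq_bigr => i _.
by rewrite E // (leq_ltn_trans _ lt_kn) // -ltnS.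
Qed.

Lemma eqX_trunc_comp n f g : g 0%N = 0 ->
  eqX n (trunc n f \Po trunc n g) (trunc n (fps_comp f g)).
Proof.
move=> g0 k lt_kn.
have lt_0n := leq_ltn_trans (leq0n k) lt_kn.
rewrite coef_comp_poly0 ?coef_trunc //; apply: eq_bigr => i _.
rewrite eqX_truncX // !coef_trunc //.
by rewrite (leq_ltn_trans _ lt_kn) // -ltnS.
Qed.

Lemma fps_mul_polyE p f g :
  fps_mul (fps_of_poly p) f = g <->
  forall n, eqX n (p * trunc n f) (trunc n g).
Proof.
have E n k : (k < n)%N -> (p * trunc n f)`_k = fps_mul (fps_of_poly p) f k.
  move=> lt_kn; rewrite coefM; apply: eq_bigr => i _.
  by rewrite coef_trunc // (leq_ltn_trans (leq_subr _ _)).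
split=> [<- n k lt_kn | H]; first by rewrite E ?coef_trunc.
by apply/funext => k; rewrite -(E k.+1) // H // coef_trunc.
Qed.

Lemma eqX_trunc_poly n p : eqX n (trunc n (fps_of_poly p)) p.
Proof. by move=> k; apply: coef_trunc. Qed.

End Truncation.

(** * Substituting x/(x-1) into a fraction of polynomials *)

Section Twist.
Variable K : idomainType.
Implicit Types (p q P Q : {poly K}) (phi : fps K).

(* The polynomial (1 - x)^N p(x/(x-1)), for N at least the degree of p. *)
Definition twist N p : {poly K} := homog polyC N p (- 'X) (1 - 'X).

Lemma eqX_twist N n p : (size p <= N)%N -> (0 < n)%N ->
  eqX n (twist N p) ((1 - 'X) ^+ N * (p \Po trunc n (@fps_xx1 K))).
Proof.
move=> leN n_gt0 k lt_kn; rewrite -homogE // !coef_sum.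
apply: eq_bigr => i _; apply: eqXM lt_kn; last by [].
apply: eqXM; first by [].
(* Modulo ['X ^+ n], the product of 1 - x with the truncation of x/(x-1) is -x. *)
apply: eqXX => -[|[|j]] lt_jn; rewrite mulrBl mul1r coefB coefXM coefN coefX;
  rewrite /= !coef_trunc ?(ltnW lt_jn) //=; ring.
Qed.

Lemma twist_coef0 N p : (size p <= N)%N -> (twist N p)`_0 = p`_0.
Proof.
move=> leN; rewrite (eqX_twist leN (ltnSn 0)) // -!horner_coef0 hornerM.
by rewrite horner_comp (horner_coef0 (trunc _ _)) coef_trunc // !hornerE subr0 expr1n mul1r.
Qed.

(** Substituting into Q phi = P and multiplying by (1 - x)^N presents phi(x/(x-1)) as the quotient
    of the twists of P and Q. Both denominators have nonzero constant term, so equality can be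
    tested by cross products. *)
Lemma rat_fixed N P Q phi : (size P <= N)%N -> (size Q <= N)%N ->
  taylor_of_rat P Q phi ->
  phi = fps_comp phi (@fps_xx1 K) <-> P * twist N Q = Q * twist N P.
Proof.
move=> leP leQ [nzQ /fps_mul_polyE mulQ]; rewrite horner_coef0 in nzQ.
set psi := fps_comp phi _.
have mulQ' n : eqX n (Q * trunc n phi) P.
  exact: eqX_trans (mulQ n) (@eqX_trunc_poly _ n P).
have mulTQ n : eqX n (twist N Q * trunc n psi) (twist N P).
  case: n => // n; set s := trunc n.+1 (@fps_xx1 K).
  have s0 : s`_0 = 0 by rewrite coef_trunc.
  apply: (@eqX_trans _ _ ((1 - 'X) ^+ N * (Q \Po s) * (trunc n.+1 phi \Po s))).
    apply: eqXM; first exact: eqX_twist.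
    exact/eqX_sym/eqX_trunc_comp.
  rewrite -mulrA -rmorphM /=; apply: eqX_trans (eqX_sym (eqX_twist leP _)) => //.
  by apply: eqXM => //; apply: eqX_comp.
split=> [fixed | PQ].
- rewrite -fixed in mulTQ; apply: eqX_all => n.
  apply: (@eqX_trans _ _ (Q * trunc n phi * twist N Q)).
    by apply: eqXM => //; apply: eqX_sym.
  rewrite -mulrA [trunc _ _ * _]mulrC.
  by apply: eqXM.
- apply/funext => k.
  rewrite -(@coef_trunc _ k.+1 phi) // -(@coef_trunc _ k.+1 psi) //.
  apply: (@eqX_cancel _ k.+1 (Q * twist N Q)) => //.
    by rewrite coef0M twist_coef0 // mulf_neq0.
  rewrite -!mulrA; apply: (@eqX_trans _ _ (Q * twist N P)); last first.
    by apply: eqXM => //; apply: eqX_sym.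
  by rewrite -PQ [twist N Q * _]mulrC mulrA; apply: eqXM.
Qed.

End Twist.

(** * Invariant fractions as quotients of polynomials in u *)

Section RationalFunctions.
Variable K : idomainType.
Implicit Types (p q A B P Q : {poly K}).

(** Horner induction, reducing t^2 to u - u t. The same [a] and [b] serve every root t, in
    particular both x and v. *)
Lemma quadratic_decomposition (F : comNzRingType) (e : {rmorphism K -> F}) p :
  exists a b, forall u t : F, t ^+ 2 = u * (1 - t) ->
    (map_poly e p).[t] = (map_poly e a).[u] + (map_poly e b).[u] * t.
Proof.
elim/poly_ind: p => [|p c [a [b IHp]]].
  by exists 0, 0 => u t _; rewrite !rmorph0 !horner0 mul0r addr0.
exists (b * 'X + c%:P), (a - b * 'X) => u t tE.
rewrite !(rmorphD, rmorphB, rmorphM, rmorphN) /= !map_polyX !map_polyC /=.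
rewrite !hornerE (IHp u t tE).
rewrite mulrDl -mulrA -expr2 tE; ring.
Qed.

Variables (F : fieldType) (tau : {rmorphism {poly K} -> F}).
Hypothesis tauI : injective tau.

Let iota : {rmorphism K -> F} := tau \o polyC.
Let x : F := tau 'X.
Let v : F := x / (x - 1).
Let u : F := tau ('X ^+ 2) / tau (1 - 'X).

Local Notation ev p t := (map_poly iota p).[t].

Lemma tau_eq0 p : (tau p == 0) = (p == 0).
Proof. by rewrite -(rmorph0 tau) (inj_eq tauI). Qed.

Lemma tau_ev p : tau p = ev p x.
Proof.
by rewrite map_poly_comp horner_map -/(comp_poly _ _) comp_polyXr.
Qed.

Lemma subr1x_neq0 : 1 - x != 0.
Proof.
rewrite -(rmorph1 tau) -rmorphB tau_eq0 -size_poly_eq0 -opprB size_polyN.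
by rewrite size_XsubC.
Qed.

Lemma mul_subr1x_v : - x = (1 - x) * v.
Proof.
by rewrite /v -opprB mulNr mulrC mulfVK // -opprB oppr_eq0 subr1x_neq0.
Qed.

Lemma u_quotE : u = x ^+ 2 / (1 - x).
Proof. by rewrite /u rmorphXn rmorphB rmorph1. Qed.

Lemma x_quad : x ^+ 2 = u * (1 - x).
Proof. by rewrite u_quotE mulfVK ?subr1x_neq0. Qed.

Lemma v_quad : v ^+ 2 = u * (1 - v).
Proof.
by rewrite u_quotE /v; field; rewrite subr1x_neq0 -opprB oppr_eq0 subr1x_neq0.
Qed.

Lemma subr1v_neq0 : 1 - v != 0.
Proof.
have E : (1 - x) * (1 - v) = 1 by rewrite mulrBr mulr1 -mul_subr1x_v opprK subrK.
by apply: contraTneq (oner_neq0 F) => v1; rewrite -E v1 mulr0 eqxx.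
Qed.

(** If v = x then -x = (1 - x) x as polynomials, and the coefficient of x gives -1 = 1. *)
Lemma v_neqx : (2 : K) != 0 -> v != x.
Proof.
move=> nz2; apply/eqP => vx; have /eqP := mul_subr1x_v; rewrite vx.
rewrite -(rmorph1 tau) -rmorphB -rmorphM -rmorphN (inj_eq tauI) => /eqP /polyP /(_ 1%N).
rewrite mulrBl mul1r coefN coefB coefX coefXM coefX /= subr0 => /eqP.
by rewrite eq_sym -addr_eq0 -mulr2n (negPf nz2).
Qed.

Lemma tau_twist N p : (size p <= N)%N ->
  tau (twist N p) = (1 - x) ^+ N * ev p v.
Proof.
move=> leN; rewrite -(homogE iota) // -mul_subr1x_v /twist rmorph_homog.
by rewrite rmorphN rmorphB rmorph1.
Qed.

Lemma twist_fracE N P Q : (size P <= N)%N -> (size Q <= N)%N ->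
  P * twist N Q = Q * twist N P <-> ev P x * ev Q v = ev Q x * ev P v.
Proof.
move=> leP leQ; have nz := expf_neq0 N subr1x_neq0.
have E p q : (size q <= N)%N ->
    tau (p * twist N q) = (1 - x) ^+ N * (ev p x * ev q v).
  by move=> leN; rewrite rmorphM tau_twist // tau_ev mulrCA.
split=> [/(congr1 tau) | H].
  by rewrite !E // => /(mulfI nz).
by apply/eqP; rewrite -(inj_eq tauI) !E // H.
Qed.

(* Clearing denominators in P/Q = A(u)/B(u) gives a polynomial identity in x,
   into which v can be substituted; u is unchanged by x -> v. *)
Lemma fixed_of_quotient A B P Q : Q != 0 ->
  ev A u / ev B u = tau P / tau Q ->
  ev P x * ev Q v = ev Q x * ev P v.
Proof.
move=> nzQ; have nzQx : ev Q x != 0 by rewrite -tau_ev tau_eq0.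
(* If B(u) = 0, the quotient is 0 by the convention for inverses, which forces P = 0. *)
rewrite !tau_ev; have [Bu0 | nzB] := eqVneq (ev B u) 0.
  rewrite Bu0 invr0 mulr0 => /esym/eqP; rewrite mulf_eq0 invr_eq0 (negPf nzQx).
  rewrite orbF -tau_ev tau_eq0 => /eqP ->.
  by rewrite map_poly0 horner0 rmorph0 mul0r mulr0.
move=> /eqP; rewrite eqr_div // => /eqP PQ.
pose N := (size A + size B)%N.
pose clear p : {poly K} := homog polyC N p ('X ^+ 2) (1 - 'X).
have clearE p t : (size p <= N)%N -> t ^+ 2 = u * (1 - t) ->
    ev (clear p) t = (1 - t) ^+ N * ev p u.
  move=> leN tE; rewrite -homogE // mulrC -tE.
  pose f : {rmorphism {poly K} -> F} := horner_eval t \o map_poly iota.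
  rewrite -[LHS]/(f (clear p)) rmorph_homog rmorphB rmorph1 rmorphXn.
  rewrite /f /= map_polyX /horner_eval hornerX.
  by apply: eq_bigr => i _; rewrite /= map_polyC /= hornerC.
have leA : (size A <= N)%N by rewrite leq_addr.
have leB : (size B <= N)%N by rewrite leq_addl.
have cleared : clear A * Q = P * clear B.
  apply/eqP; rewrite -(inj_eq tauI) !rmorphM !tau_ev !clearE ?x_quad //.
  by rewrite -mulrA PQ mulrCA.
have : ev A u * ev Q v = ev P v * ev B u.
  apply: (mulfI (expf_neq0 N subr1v_neq0)).
  by rewrite mulrA [RHS]mulrCA -!clearE ?v_quad // -!hornerM -!rmorphM cleared.
move=> PQv; apply: (mulfI nzB); rewrite !mulrA [ev B u * _]mulrC -PQ.
by rewrite mulrAC PQv; ring.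
Qed.

(* Writing P = a + b x and Q = c + d x with a, b, c, d polynomials in u, the
   hypothesis reads (a d - b c)(v - x) = 0, so P/Q = a/c, or b/d when c = 0. *)
Lemma quotient_of_fixed P Q : (2 : K) != 0 -> Q != 0 ->
  ev P x * ev Q v = ev Q x * ev P v ->
  exists A B, B != 0 /\ ev A u / ev B u = tau P / tau Q.
Proof.
move=> nz2 nzQ; have nzQx : ev Q x != 0 by rewrite -tau_ev tau_eq0.
rewrite !tau_ev.
have [a [b Pab]] := quadratic_decomposition iota P.
have [c [d Qcd]] := quadratic_decomposition iota Q.
have nz_poly p : ev p u != 0 -> p != 0.
  by apply: contra_neq => ->; rewrite map_poly0 horner0.
rewrite (Pab _ _ x_quad) (Pab _ _ v_quad) (Qcd _ _ v_quad).
rewrite (Qcd _ _ x_quad) in nzQx *.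
set a' := ev a u; set b' := ev b u; set c' := ev c u; set d' := ev d u.
rewrite -/c' -/d' in nzQx => H.
have adbc : a' * d' = b' * c'.
  apply/eqP; rewrite -subr_eq0; apply/eqP.
  apply: (@mulIf _ (v - x)); first by rewrite subr_eq0 v_neqx.
  move/eqP: H; rewrite mul0r -subr_eq0 => /eqP <-; ring.
have [c0 | nzc] := eqVneq c' 0.
- have nzd : d' != 0.
    by apply: contraNneq nzQx => ->; rewrite c0 mul0r addr0.
  have a0 : a' = 0.
    by apply: (mulIf nzd); rewrite adbc c0 mul0r mulr0.
  exists b, d; split; first exact: nz_poly.
  apply/eqP; rewrite -/b' -/d' eqr_div // a0 c0; apply/eqP; ring.
- exists a, c; split; first exact: nz_poly.
  apply/eqP; rewrite -/a' -/c' eqr_div // mulrDr mulrA adbc; apply/eqP; ring.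
Qed.

End RationalFunctions.

(** * Specialization to complex coefficients and their fraction field *)

Theorem theorem1p6 (R : realType) :
  (forall phi : fps R[i], symplectic phi <-> phi = fps_comp phi (@fps_xx1 R[i])) /\
  (forall (P Q : {poly R[i]}) (phi : fps R[i]),
     taylor_of_rat P Q phi ->
     (symplectic phi <->
        exists A B : {poly R[i]}, B != 0 /\
          let u : {fraction {poly R[i]}} := tofrac ('X ^+ 2) / tofrac (1 - 'X) in
          (map_poly (fun c : R[i] => tofrac c%:P) A).[u] / (map_poly (fun c : R[i] => tofrac c%:P) B).[u] = tofrac P / tofrac Q) /\
     (symplectic phi <-> phi = fps_comp phi (@fps_xx1 R[i]))).
Proof.
have nz2 : (2 : R[i]) != 0 by rewrite pnatr_eq0.
have fixedP phi := symplectic_fixed phi nz2.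
split=> // P Q phi PQphi; split=> //.
have nzQ : Q != 0.
  by apply: contra_neq (proj1 PQphi) => ->; rewrite horner0.
rewrite fixedP.
(* The twisting degree is [size P + size Q], a common bound for both sizes. *)
rewrite (rat_fixed (leq_addr (size Q) (size P)) (leq_addl _ _) PQphi).
pose tau : {rmorphism {poly R[i]} -> {fraction {poly R[i]}}} :=
  @tofrac {poly R[i]}.
have tauI : injective tau by move=> p q /eqP; rewrite tofrac_eq => /eqP.
rewrite (twist_fracE tauI) ?leq_addr ?leq_addl //; split.
- exact: (quotient_of_fixed tauI).
- by move=> [A [B [_ AB]]]; apply: (fixed_of_quotient tauI) AB.
Qed.
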